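(* Let $(\Omega,\mathcal F)$ be a measurable space with a filtration $\{\mathcal F_m\}_{m=0}^\infty$, $\mathcal F_0=\{\emptyset,\Omega\}$, and let $M$ be a convex set of equivalent measures on $\mathcal F$. Let the set $A_0$ be uniformly integrable relative to every measure $P\in M$. Suppose that for a nonnegative $\mathcal F_N$-measurable contingent claim $f_N$, $N<\infty$, integrable relative to every $P\in M$, there exist $\alpha_0<\infty$ and $\xi_0\in A_0$ such that $$P\big(f_N-\alpha_0E^P\{\xi_0|\mathcal F_N\}\le0\big)=1.$$ Then a fair price $f_0$ of the contingent claim $f_N$ relative to $M$ exists, and the inequality $$\sup_{P\in M}E^Pf_N\le f_0$$ is valid. If the supermartingale $\{f_m=\operatorname{ess\,sup}_{P\in M}E^P\{f_N|\mathcal F_m\},\mathcal F_m\}_{m=0}^\infty$ is local regular, then $f_0=\sup_{P\in M}E^Pf_N$.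
   Context: Setting. $(\Omega,\mathcal F)$ is a measurable space with filtration $\mathcal F_m\subset\mathcal F_{m+1}\subset\mathcal F$, $m=0,1,2,\dots$, $\mathcal F_0=\{\emptyset,\Omega\}$. $M$ is a convex set of mutually equivalent probability measures on $\mathcal F$; $E^P$ is expectation under $P$. A process is adapted if its $m$-th term is $\mathcal F_m$-measurable. An adapted process $\{f_m\}$ is a supermartingale relative to $M$ if $E^P|f_m|<\infty$ for $m\ge 1$, $P\in M$, and $E^P\{f_m|\mathcal F_k\}\le f_k$ for $0\le k\le m$, $P\in M$. $A_0$ is the set of all nonnegative random variables $\xi$, integrable relative to all $P\in M$, with $E^P\xi=1$ for all $P\in M$. In relations of the form $P(f_N-\alpha E^P\{\xi|\mathcal F_N\}\le0)=1$, $P$ ranges over $M$. Fair price. Let $f_N$, $N<\infty$, be $\mathcal F_N$-measurable, integrable relative to $M$, and such that for some $0\le\alpha_0<\infty$, $\xi_0\in A_0$, $P(f_N-\alpha_0E^P\{\xi_0|\mathcal F_N\}\le0)=1$. Put $G_{\alpha_0}=\{\alpha\in[0,\alpha_0]:\ \exists\,\xi_\alpha\in A_0,\ P(f_N-\alpha E^P\{\xi_\alpha|\mathcal F_N\}\le0)=1\}$. The number $f_0=\inf_{\alpha\in G_{\alpha_0}}\alpha$ is called a fair price of the contingent claim $f_N$ relative to $M$ if there exist $\zeta_0\in A_0$ and sequences $\alpha_n\in[0,\alpha_0]$, $\xi_{\alpha_n}\in A_0$ with $\alpha_n\to f_0$, $\xi_{\alpha_n}\to\zeta_0$ in probability as $n\to\infty$,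 and $P(f_N-\alpha_nE^P\{\xi_{\alpha_n}|\mathcal F_N\}\le0)=1$ for all $n\ge1$. Regular supermartingale. Let $\{f_m,\mathcal F_m\}$ be a supermartingale relative to $M$ for which there are a random variable $\varphi$ and a real $T$ with $|f_m|\le\varphi$ for all $m\ge 0$ and $E^Q\varphi<T<\infty$ for all $Q\in M$ ($T$ not depending on $Q$). For $\hat P_1,\dots,\hat P_s\in M$ put $\hat M_s=\{\sum_{i=1}^s\gamma_i\hat P_i:\gamma_i\ge0,\sum_i\gamma_i=1\}$ and let $G_s$ be the set of adapted non-decreasing processes $g=\{g_m\}_{m=0}^\infty$, $g_0=0$, such that $\{f_m+g_m\}$ is a supermartingale relative to all measures in $\hat M_s$. Processes are partially ordered by $g^1\preceq g^2$ iff $g^1_m\le g^2_m$ almost surely for all $m$; a maximal chain is a totally ordered subset maximal under inclusion. The supermartingale is called regular if for every finite family $\hat P_1,\dots,\hat P_s\in M$ satisfying $0<l\le \frac{d\hat P_i}{d\hat P_j}\le L<\infty$, $i,j=1,\dots,s$ (with real $l,L$ depending on the family): (i) there exist $1\le m_0<\infty$ and an $\mathcal F_{m_0-1}$-measurable nonnegative random variable $\varphi_{m_0}^s$ with $\hat P_1(\varphi_{m_0}^s>0)>0$ such that $f_{m_0-1}-E^{\hat P_i}\{f_{m_0}|\mathcal F_{m_0-1}\}\ge\varphi_{m_0}^s$, $i=1,\dots,s$; (ii) for the maximal element $g^s=\{g^s_m\}$ in a certain maximal chain $\tilde G_s\subseteq G_s$, $E^{\hat P_i}\{f_m+g^s_m|\mathcal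 F_k\}=f_k+g_k^s$ for $0\le k\le m$, $m\ge1$, $i=1,\dots,s$; and moreover (iii) there exists an adapted nonnegative process $\bar g^0=\{\bar g^0_m\}_{m=0}^\infty$, $\bar g^0_0=0$, $E^P\bar g_m^0<\infty$ for $m\ge1$, $P\in M$, not depending on the family $\hat P_1,\dots,\hat P_s$, such that $E^{\hat P_i}\{g_m^s-g_{m-1}^s|\mathcal F_{m-1}\}=E^{\hat P_i}\{\bar g^0_m|\mathcal F_{m-1}\}$ for $m\ge1$, $i=1,\dots,s$. Local regular supermartingale. A supermartingale $f$ with $\sup_{P\in M}E^P|f_m|<\infty$ for all $m\ge0$ is local regular if there is an increasing sequence of nonrandom times $\tau_{k_s}=k_s<\infty$, $k_s\to\infty$ as $s\to\infty$, such that for every $s$ the stopped process $\{f_{m\wedge k_s},\mathcal F_m\}_{m=0}^\infty$ is a regular supermartingale relative to $M$. *)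

(* Defs.v *)
From HB Require Import structures.
From mathcomp Require Import all_boot all_order all_algebra.
From mathcomp Require Import all_classical all_reals all_analysis.
From mathcomp Require Import measurable_realfun.

Set Implicit Arguments.
Unset Strict Implicit.
Unset Printing Implicit Defensive.

Import Order.TTheory GRing.Theory Num.Theory.
Import numFieldNormedType.Exports.

Local Open Scope classical_set_scope.
Local Open Scope ring_scope.

Section conditional_expectation.
Context {d : measure_display} {T : measurableType d} {R : realType}.
Implicit Types (P : probability T R) (G : set (set T)) (X Y : T -> R).

Definition measurable_wrt G X : Prop :=
  measurable_fun [set: g_sigma_algebraType G] (X : g_sigma_algebraType G -> R).

Definition is_condexp P G X Y : Prop :=
  [/\ measurable_wrt G Y,
      P.-integrable [set: T] (EFin \o Y) &
      forall A, G A ->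
        (\int[P]_(w in A) (Y w)%:E = \int[P]_(w in A) (X w)%:E)%E].

(* A version of E^P{X | G}. The default value is never used when G is a
   sub-sigma-algebra and X is integrable (lemma condexpP). *)
Definition condexp P G X : T -> R := xget (cst 0) [set Y | is_condexp P G X Y].

Lemma condexp_mfun d' (T' : measurableType d') P (phi : {mfun T >-> T'}) X :
  P.-integrable [set: T] (EFin \o X) ->
  exists Y : T' -> R,
    [/\ measurable_fun [set: T'] Y,
        P.-integrable [set: T] (EFin \o (Y \o phi)) &
        forall A, measurable A ->
          (\int[P]_(w in phi @^-1` A) (Y (phi w))%:E =
           \int[P]_(w in phi @^-1` A) (X w)%:E)%E].
Proof.
move=> iX; have mphi : measurable_fun [set: T] phi by [].
have mX := measurable_int _ iX.
pose mu : probability T' R := distribution P phi.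
pose nu : {charge set T' -> \bar R} :=
  [the charge _ _ of pushforward (induced_charge iX) phi].
have mpre A : measurable A -> measurable (phi @^-1` A).
  by move=> mA; rewrite -[X in measurable X]setTI; exact: (mphi).
have numu : nu mphi `<< mu.
  apply/null_content_dominatesP => A mA PA0.
  rewrite /nu /= /pushforward/= /induced_charge.
  apply: null_set_integral => //; first exact: mpre.
  exact: (measurable_funS measurableT).
pose f := Radon_Nikodym (nu mphi) mu.
have if_ : mu.-integrable [set: T'] f := Radon_Nikodym_integrable numu.
have mf : measurable_fun [set: T'] f := measurable_int _ if_.
have fE : EFin \o ((fine \o f) \o phi) = f \o phi.
  by apply/funext => w /=; rewrite fineK// Radon_Nikodym_fin_num.
have ifphi : P.-integrable [set: T] (f \o phi).
  apply/integrableP; split; first exact: measurableT_comp.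
  have /integrableP[_] := if_.
  rewrite ge0_integral_pushforward//=.
  exact: measurableT_comp.
exists (fine \o f); split.
- exact: measurableT_comp.
- by rewrite fE.
- move=> A mA; have := Radon_Nikodym_integral numu mA.
  rewrite [X in _ = X -> _]integral_pushforward//; last first.
    by apply: (integrableS measurableT) => //; exact: mpre.
  move=> nuA; transitivity (\int[P]_(w in phi @^-1` A) (f \o phi) w)%E.
    by apply: eq_integral => w _; exact: (congr1 (fun g => g w) fE).
  exact: esym nuA.
Qed.

Lemma condexp_exists P G X : sigma_algebra [set: T] G -> G `<=` measurable ->
  P.-integrable [set: T] (EFin \o X) -> exists Y, is_condexp P G X Y.
Proof.
move=> sG GT iX.
have mid : measurable_fun [set: T] (id : T -> g_sigma_algebraType G).
  move=> _ A mA; rewrite setTI.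
  by apply: GT; move: mA; rewrite /measurable/= sigma_algebra_id.
pose phi : {mfun T >-> g_sigma_algebraType G} :=
  MeasurableFun.Pack (MeasurableFun.Class (isMeasurableFun.Build _ _ _ _ _ mid)).
have [Y [mY iY YX]] := condexp_mfun phi iX.
exists Y; split => // A GA.
by apply: YX; exact: sub_sigma_algebra.
Qed.

Lemma condexpP P G X : sigma_algebra [set: T] G -> G `<=` measurable ->
  P.-integrable [set: T] (EFin \o X) -> is_condexp P G X (condexp P G X).
Proof.
move=> sG GT iX; have [Y PXY] := condexp_exists sG GT iX.
by apply: (@xgetPex _ (cst 0) [set Z | is_condexp P G X Z]); exists Y.
Qed.

End conditional_expectation.

Section families_of_measures.
Context {d : measure_display} {T : measurableType d} {R : realType}.
Implicit Types (P Q : probability T R) (M : set (probability T R)).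
Implicit Types (X Y : T -> R) (A : set (T -> R)) (F : nat -> set (set T)).
Implicit Types (f g : nat -> T -> R).

(* Measures are compared on measurable sets only: a [probability T R] is a
   function on all subsets of T, with unspecified values off the
   sigma-algebra. *)
Definition convex_measures M : Prop :=
  forall P Q (a : R), M P -> M Q -> 0 <= a <= 1 ->
    exists2 S, M S & forall B, measurable B ->
      S B = (a%:E * P B + (1 - a)%:E * Q B)%E.

Definition equivalent_measures M : Prop := forall P Q, M P -> M Q -> P `<< Q.

Definition filtration F : Prop :=
  [/\ forall m, sigma_algebra [set: T] (F m),
      forall m, F m `<=` F m.+1 &
      forall m, F m `<=` measurable].

Definition adapted F f : Prop := forall m, measurable_wrt (F m) (f m).

Definition integrable_all M X : Prop :=
  forall P, M P -> P.-integrable [set: T] (EFin \o X).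

Definition ae_all M (E : T -> Prop) : Prop :=
  forall P, M P -> \forall w \ae P, E w.

Definition supermartingale F M f : Prop :=
  [/\ adapted F f,
      forall m, (1 <= m)%N -> integrable_all M (f m) &
      forall k m P, (k <= m)%N -> M P ->
        \forall w \ae P, condexp P (F k) (f m) w <= f k w].

Definition A0 M : set (T -> R) :=
  [set xi | [/\ forall w, 0 <= xi w, integrable_all M xi &
                forall P, M P -> ('E_P[xi] = 1)%E]].

Definition uniformly_integrable P A : Prop :=
  ereal_sup [set (\int[P]_(w in [set w | (c < `|X w|)%R]) `|X w|%:E)%E | X in A]
    @[c --> +oo%R] --> 0%E.

Definition cvg_in_probability P (X : nat -> T -> R) Y : Prop :=
  forall e : R, 0 < e -> P [set w | e < `|X n w - Y w|] @[n --> \oo] --> 0%E.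

Definition is_ess_sup M A X : Prop :=
  [/\ measurable_fun [set: T] X,
      forall Y, A Y -> ae_all M (fun w => Y w <= X w) &
      forall Z, measurable_fun [set: T] Z ->
        (forall Y, A Y -> ae_all M (fun w => Y w <= Z w)) ->
        ae_all M (fun w => X w <= Z w)].

Definition superhedges F M N X (alpha : R) xi : Prop :=
  forall P, M P -> P [set w | X w - alpha * condexp P (F N) xi w <= 0] = 1%E.

Definition price_set F M N X (alpha0 : R) : set R :=
  [set alpha | 0 <= alpha <= alpha0 /\
     exists2 xi, A0 M xi & superhedges F M N X alpha xi].

Definition is_fair_price F M N X (alpha0 f0 : R) : Prop :=
  f0 = inf (price_set F M N X alpha0) /\
  exists (zeta0 : T -> R) (alpha : nat -> R) (xi : nat -> T -> R),
    [/\ A0 M zeta0,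
        forall n, 0 <= alpha n <= alpha0 /\ A0 M (xi n),
        alpha n @[n --> \oo] --> f0,
        forall P, M P -> cvg_in_probability P xi zeta0 &
        forall n, superhedges F M N X (alpha n) (xi n)].

Definition mixtures s (Phat : 'I_s.+1 -> probability T R) :
    set (probability T R) :=
  [set Q | exists gamma : 'I_s.+1 -> R,
     [/\ forall i, 0 <= gamma i, \sum_i gamma i = 1 &
         forall B, measurable B -> Q B = (\sum_i (gamma i)%:E * Phat i B)%E]].

Definition process_le M g1 g2 : Prop :=
  forall m, ae_all M (fun w => g1 m w <= g2 m w).

(* The set G_s, with M the set of mixtures of the family. *)
Definition compensators F M f : set (nat -> T -> R) :=
  [set g | [/\ adapted F g, forall w, g 0%N w = 0,
               forall m, ae_all M (fun w => g m w <= g m.+1 w) &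
               supermartingale F M (fun m w => f m w + g m w)]].

(* Processes are not quotiented by almost sure equality, so [process_le] is only
   a preorder; a maximal chain contains all adapted versions of its elements. *)
Definition maximal_chain M (S C : set (nat -> T -> R)) : Prop :=
  [/\ C `<=` S, total_on C (process_le M) &
      forall C', C' `<=` S -> total_on C' (process_le M) ->
        C `<=` C' -> C' = C].

Definition comparable_densities s (Phat : 'I_s.+1 -> probability T R) : Prop :=
  exists l L : R, 0 < l /\ forall i j, \forall w \ae Phat j,
    (l%:E <= Radon_Nikodym (charge_of_finite_measure (Phat i)) (Phat j) w <=
     L%:E)%E.

Definition regular_supermartingale F M f : Prop :=
  [/\ supermartingale F M f,
      exists (phi : T -> R) (bound : R),
        [/\ measurable_fun [set: T] phi,
            forall m, ae_all M (fun w => `|f m w| <= phi w) &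
            forall Q, M Q -> ('E_Q[phi] < bound%:E)%E] &
      exists gbar : nat -> T -> R,
        [/\ adapted F gbar, forall m w, 0 <= gbar m w,
            forall w, gbar 0%N w = 0,
            forall m, (1 <= m)%N -> integrable_all M (gbar m) &
        forall s (Phat : 'I_s.+1 -> probability T R),
          (forall i, M (Phat i)) -> comparable_densities Phat ->
          (exists (m0 : nat) (phi : T -> R),
             [/\ (1 <= m0)%N, measurable_wrt (F m0.-1) phi,
                 forall w, 0 <= phi w,
                 (0 < Phat ord0 [set w | (0 < phi w)%R])%E &
                 forall i, \forall w \ae Phat i,
                   phi w <=
                   f m0.-1 w - condexp (Phat i) (F m0.-1) (f m0) w]) /\
          (exists (C : set (nat -> T -> R)) (g : nat -> T -> R),
             let Mhat := mixtures Phat in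
             [/\ maximal_chain Mhat (compensators F Mhat f) C,
                 C g /\ (forall h, C h -> process_le Mhat h g),
                 forall k m i, (k <= m)%N -> (1 <= m)%N ->
                   \forall w \ae Phat i,
                     condexp (Phat i) (F k) (fun w' => f m w' + g m w') w =
                     f k w + g k w &
                 forall m i, (1 <= m)%N -> \forall w \ae Phat i,
                   condexp (Phat i) (F m.-1)
                     (fun w' => g m w' - g m.-1 w') w =
                   condexp (Phat i) (F m.-1) (gbar m) w])]].

Definition local_regular_supermartingale F M f : Prop :=
  [/\ supermartingale F M f,
      forall m,
        (ereal_sup [set ('E_P[(fun w => (`|f m w|)%R)])%E | P in M] < +oo)%E &
      exists k : nat -> nat,
        [/\ {homo k : s t / (s <= t)%N}, k s @[s --> \oo] --> \oo &
            forall s, regular_supermartingale F M (fun m => f (minn m (k s)))]].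

End families_of_measures.

(* Main.v *)
(* Superhedging at price alpha with xi means that, for every P in M and every
   event A of F_N, the P-integral of f_N over A is at most alpha times that of
   xi. This is affine in xi and monotone in alpha.

   Existence of the fair price: let C_n be the convex set of the xi in A_0 that
   superhedge at a price alpha_n decreasing to the infimum of all such prices.
   Almost minimizers xi_n of E exp(-xi) over C_n, chosen well, make exp(-xi_n/2)
   so rapidly Cauchy in mean square that xi_n converges almost surely; by Fatou's
   lemma the limit is finite, and by uniform integrability it lies in A_0.

   Local regularity: regularity for the families {P}, P in M, gives one adapted
   nonnegative process gbar with E^P f_m + E^P gbar_m = E^P f_(m-1) for all P
   in M. The initial value c of the process f is the constant sup_P E^P f_N, so
   f_N + gbar_1 + ... + gbar_N has expectation c under every P in M; divided by c
   it is an element of A_0 that superhedges f_N at the price c. *)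
Require Import Defs.
From mathcomp Require Import all_boot all_order all_algebra.
From mathcomp Require Import all_classical all_reals all_analysis.
From mathcomp Require Import measurable_realfun.
From mathcomp Require Import ring lra.

Set Implicit Arguments.
Unset Strict Implicit.
Unset Printing Implicit Defensive.

Import Order.TTheory GRing.Theory Num.Theory.
Import numFieldNormedType.Exports.

Local Open Scope classical_set_scope.
Local Open Scope ring_scope.

(** * Measurability with respect to a sub-sigma-algebra *)

Lemma measurable_wrt_preimage {d : measure_display} {T : measurableType d}
    {R : realType} (G : set (set T)) (X : T -> R) (B : set R) :
  sigma_algebra [set: T] G -> measurable_wrt G X -> measurable B ->
  G (X @^-1` B).
Proof.
move=> sG mX mB; have := mX measurableT B mB.
by rewrite setTI /measurable/= sigma_algebra_id.
Qed.

Lemma measurable_wrtS {d : measure_display} {T : measurableType d}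
    {R : realType} (G H : set (set T)) (X : T -> R) :
  sigma_algebra [set: T] G -> sigma_algebra [set: T] H -> G `<=` H ->
  measurable_wrt G X -> measurable_wrt H X.
Proof.
move=> sG sH GH mX _ B mB; rewrite setTI.
by apply: sub_sigma_algebra; apply/GH/(measurable_wrt_preimage sG).
Qed.

Lemma measurable_wrt_fun {d : measure_display} {T : measurableType d}
    {R : realType} (G : set (set T)) (X : T -> R) :
  sigma_algebra [set: T] G -> G `<=` measurable ->
  measurable_wrt G X -> measurable_fun [set: T] X.
Proof.
move=> sG GT mX _ B mB; rewrite setTI.
by apply/GT/(measurable_wrt_preimage sG).
Qed.

(** * Real-valued integrals and almost sure comparison *)

Section expectations.
Context {d : measure_display} {T : measurableType d} {R : realType}.
Variable P : probability T R.
Implicit Types X Y Z : T -> R.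

Lemma EFin_Rintegral X (A : set T) : measurable A ->
  P.-integrable A (EFin \o X) ->
  (\int[P]_(w in A) X w)%:E = (\int[P]_(w in A) (X w)%:E)%E.
Proof. by move=> mA iX; rewrite fineK//; exact: integrable_fin_num. Qed.

Lemma Rintegral_expectation X (r : R) : P.-integrable [set: T] (EFin \o X) ->
  ('E_P[X] = r%:E)%E <-> \int[P]_w X w = r.
Proof.
by move=> iX; rewrite unlock -EFin_Rintegral//; split=> [[]|->].
Qed.

Lemma probability_Rintegral_cst (r : R) : \int[P]_w r = r.
Proof.
have P1 := congr1 fine (probability_setT P).
by rewrite (Rintegral_cst P measurableT) [X in r * X]P1 mulr1.
Qed.

Lemma ae_le_Rintegral X Y (A : set T) : measurable A ->
  P.-integrable [set: T] (EFin \o X) -> P.-integrable [set: T] (EFin \o Y) ->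
  (\forall w \ae P, X w <= Y w) ->
  \int[P]_(w in A) X w <= \int[P]_(w in A) Y w.
Proof.
move=> mA iX iY XY.
have mX : measurable_fun [set: T] X by apply/measurable_EFinP/(measurable_int P).
have mY : measurable_fun [set: T] Y by apply/measurable_EFinP/(measurable_int P).
have iS Z : P.-integrable [set: T] (EFin \o Z) -> P.-integrable A (EFin \o Z).
  exact: integrableS.
have iYX : P.-integrable [set: T] (EFin \o (fun w => Y w - X w)).
  exact: (integrableB measurableT iY iX).
rewrite -subr_ge0 -RintegralB//; [|exact: iS..].
(* [Y - X] is nonnegative only almost surely; its absolute value is nonnegative everywhere and has
   the same integral. *)
rewrite [X in 0 <= X](_ : _ = \int[P]_(w in A) `|Y w - X w|).
  by apply: Rintegral_ge0.
congr fine; apply: ae_eq_integral => //.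
- by apply/measurable_EFinP/measurable_funTS/measurable_funB.
- by apply/measurable_EFinP/measurable_funTS/measurableT_comp => //; exact: measurable_funB.
- by apply: filterS XY => w /= XY _; rewrite ger0_norm// subr_ge0.
Qed.

Lemma ae_probability_eq1 (A : set T) : measurable A ->
  P A = 1%E <-> \forall w \ae P, A w.
Proof.
move=> mA; have mAC := measurableC mA; split => [PA1|].
  apply/negligibleP; first exact: mAC.
  by rewrite [LHS](probability_setC P mA) PA1 subee.
move=> /(negligibleP P mAC).1 PA0.
by rewrite -[A]setCK probability_setC// PA0 sube0.
Qed.

(* Comparing [X] and [Y] on the set [Y < X], which lies in [G], turns an
   inequality between integrals into an almost sure one. *)
Lemma ae_le_measurable_wrt (G : set (set T)) X Y :
  sigma_algebra [set: T] G -> G `<=` measurable ->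
  measurable_wrt G X -> measurable_wrt G Y ->
  P.-integrable [set: T] (EFin \o X) -> P.-integrable [set: T] (EFin \o Y) ->
  (forall A, G A -> \int[P]_(w in A) X w <= \int[P]_(w in A) Y w) <->
  \forall w \ae P, X w <= Y w.
Proof.
move=> sG GT mX mY iX iY; split => [XY|XY A GA]; last first.
  by apply: ae_le_Rintegral => //; exact: GT.
pose A := [set w | Y w < X w].
have mXY : measurable_wrt G (fun w => X w - Y w) by exact: measurable_funB.
have GA : G A.
  rewrite (_ : A = (fun w => X w - Y w) @^-1` `]0, +oo[%classic).
    exact: measurable_wrt_preimage.
  by apply/seteqP; split => w; rewrite /A/= in_itv/= andbT subr_gt0.
have mA := GT _ GA.
have iS Z : P.-integrable [set: T] (EFin \o Z) -> P.-integrable A (EFin \o Z).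
  exact: integrableS.
have iXY : P.-integrable A (EFin \o (fun w => X w - Y w)).
  exact: (integrableB mA (iS _ iX) (iS _ iY)).
(* The integrand is positive on [A], while the hypothesis for [A] makes its integral at most 0;
   hence [A] is a null set. *)
have int0 : \int[P]_(w in A) (X w - Y w) = 0.
  apply/eqP; rewrite eq_le Rintegral_ge0 ?andbT.
    by rewrite RintegralB ?subr_le0 ?XY//; exact: iS.
  by move=> w; rewrite subr_ge0 => /ltW.
have : (\int[P]_(w in A) `|(EFin \o (fun w => X w - Y w)%R) w|)%E = 0%E.
  transitivity (\int[P]_(w in A) (X w - Y w)%R%:E)%E.
    apply: eq_integral => w /set_mem Aw /=.
    by rewrite ger0_norm// subr_ge0 ltW.
  by rewrite -EFin_Rintegral// int0.
move=> /(ae_eq_integral_abs P mA (measurable_int _ iXY)).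
apply: filterS => w /= XY0; rewrite leNgt; apply/negP => YX.
by have [/eqP] := XY0 YX; rewrite subr_eq0 gt_eqF.
Qed.

End expectations.

(** * Almost sure convergence of almost minimizers *)

Section convergence.
Context {d : measure_display} {T : measurableType d} {R : realType}.
Variable P : probability T R.
Implicit Types X Y Z : T -> R.

(** The bounds [c / 2^(n+1)] add up to [c], so the sum of the absolute increments has finite mean
    and is finite almost surely; there the telescoping series converges absolutely. *)
Lemma ae_cvg_summable_mean (h : nat -> T -> R) (c : R) : 0 <= c ->
  (forall n, measurable_fun [set: T] (h n)) ->
  (forall n, \int[P]_w `|h n.+1 w - h n w|%:E <= (c / (2 ^ n.+1)%:R)%:E)%E ->
  \forall w \ae P, cvgn (h ^~ w).
Proof.
move=> c0 mh hc.
pose D n w := (`|h n.+1 w - h n w|%:E)%E.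
have mD n : measurable_fun [set: T] (D n).
  by apply/measurable_EFinP/measurableT_comp => //; exact: measurable_funB.
have D0 n w : [set: T] w -> (0 <= D n w)%E by rewrite lee_fin.
have mS : measurable_fun [set: T] (fun w => \sum_(n <oo) D n w)%E.
  exact: (@ge0_emeasurable_sum _ T R _ D predT (fun n w Tw _ => D0 n w Tw)).
have iS : P.-integrable [set: T] (fun w => \sum_(n <oo) D n w)%E.
  apply/integrableP; split => //.
  rewrite (eq_integral (fun w => \sum_(n <oo) D n w)%E); last first.
    by move=> w _; rewrite gee0_abs//; apply: nneseries_ge0 => n _ _; exact: D0.
  rewrite integral_nneseries//.
  apply: (@le_lt_trans _ _ c%:E); last exact: ltry.
  apply: le_trans (epsilon_trick0 xpredT c0).
  by apply: lee_nneseries => [i _ _|n _]; [apply: integral_ge0 => w; exact: D0|exact: hc].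
have := integrable_ae measurableT iS.
apply: filterS => w /(_ Logic.I) fS.
have : cvgn (series (telescope (h ^~ w))).
  apply: normed_cvg; apply: nondecreasing_is_cvgn.
    by apply: nondecreasing_series => n _ _ /=.
  exists (fine (\sum_(n <oo) D n w)%E) => _ [n _ <-].
  rewrite -lee_fin fineK//; apply: le_trans (nneseries_lim_ge n _) => [|i _ _]; last exact: D0.
  by rewrite /= sumEFin.
rewrite telescopeK => cv.
rewrite (_ : h ^~ w = (fun n => (h n w - h 0%N w) + cst (h 0%N w) n)).
  by apply: is_cvgD => //; exact: is_cvg_cst.
by apply/funext => n /=; rewrite subrK.
Qed.

Lemma bounded_integrable01 X : measurable_fun [set: T] X ->
  (forall w, 0 <= X w <= 1) -> P.-integrable [set: T] (EFin \o X).
Proof.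
move=> mX X01; have i1 := finite_measure_integrable_cst P 1 measurableT.
apply: (le_integrable measurableT _ _ i1).
- exact/measurable_EFinP.
- by move=> w _ /=; have /andP[? ?] := X01 w; rewrite lee_fin normr1 ger0_norm.
Qed.

(* Almost minimizers of [E e^{-X}]: by the identity
   [(e^{-a/2} - e^{-b/2})^2 = e^{-a} + e^{-b} - 2 e^{-(a+b)/2}], convexity makes
   [e^{-X_n/2}] a Cauchy sequence in mean square. *)
Lemma ae_cvg_convex (C : nat -> set (T -> R)) :
  (forall n, C n !=set0) ->
  (forall m n, (m <= n)%N -> C n `<=` C m) ->
  (forall n X, C n X -> measurable_fun [set: T] X) ->
  (forall n X w, C n X -> 0 <= X w) ->
  (forall n X Y, C n X -> C n Y -> C n (fun w => 2^-1 * (X w + Y w))) ->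
  exists xi : nat -> T -> R, (forall n, C n (xi n)) /\
    \forall w \ae P, cvgn (fun n => expR (- (xi n w / 2))).
Proof.
move=> Cne Cdec Cmeas Cge0 Cmid.
pose phi X := \int[P]_w expR (- X w).
have mE n X (r : R) : C n X -> measurable_fun [set: T] (fun w => expR (- (X w / r))).
  move=> /Cmeas mX; apply: measurableT_comp => //; apply: measurableT_comp => //.
  exact: measurable_funM.
have E01 n X (r : R) w : C n X -> 0 <= r -> 0 <= expR (- (X w / r)) <= 1.
  move=> CX r0; rewrite expR_ge0/= -expR0 ler_expR oppr_le0 divr_ge0//.
  exact: Cge0 CX.
have iE n X r : 0 <= r -> C n X -> P.-integrable [set: T] (EFin \o (fun w => expR (- (X w / r)))).
  by move=> r0 CX; apply: bounded_integrable01 => [|w]; [exact: mE CX|exact: E01 CX r0].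
have iE1 n X : C n X -> P.-integrable [set: T] (EFin \o (fun w => expR (- X w))).
  move=> /iE => /(_ _ ler01); under [X in EFin \o X]eq_fun do rewrite divr1.
  by [].
have phi01 n X : C n X -> 0 <= phi X <= 1.
  move=> CX; rewrite /phi Rintegral_ge0 => [/=|w _]; last exact: expR_ge0.
  rewrite -[leRHS](probability_Rintegral_cst P 1).
  apply: le_Rintegral => //; first exact: iE1 CX.
    exact: finite_measure_integrable_cst.
  by move=> w _; rewrite -expR0 ler_expR oppr_le0; exact: Cge0 CX.
pose J n := inf (phi @` C n).
have lbJ n : has_lbound (phi @` C n).
  by exists 0 => _ [X /phi01/andP[? _] <-].
have ne n : phi @` C n !=set0 by have [X CX] := Cne n; exists (phi X), X.
(* The infima [J n] increase because the sets [C n] shrink. They stay in [0, 1], so their supremum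
   [S] below is finite. *)
have Jphi n X : C n X -> J n <= phi X by move=> CX; apply: ge_inf => //; exists X.
have J01 n : 0 <= J n <= 1.
  apply/andP; split.
    by apply: lb_le_inf => // _ [X /phi01/andP[? _] <-].
  have [X CX] := Cne n; apply: le_trans (Jphi _ _ CX) _.
  by have /andP[] := phi01 _ _ CX.
have ubJ : has_ubound (range J) by exists 1 => _ [n _ <-]; have /andP[] := J01 n.
pose S := sup (range J).
have JS n : J n <= S by apply: ub_le_sup => //; exists n.
have Jmono m n : (m <= n)%N -> J m <= J n.
  move=> mn; apply: lb_le_inf => // _ [X CX <-]; apply: Jphi; exact: Cdec CX.
(* Errors of order [t n ^+ 2] in the functional become increments of order [t n] in mean, which are
   summable. *)
pose t n : R := (2 ^ n.+1)%:R^-1.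
have t0 n : 0 < t n by rewrite invr_gt0 ltr0n expn_gt0.
have tS n : t n.+1 <= t n by rewrite lef_pV2 ?posrE ?ltr0n ?expn_gt0// ler_nat leq_exp2l.
(* The index [kX.1] is so large that its infimum is nearly [S], and at least [n] so that the almost
   minimizer [kX.2] lies in [C n]. *)
have choose_xi n : exists kX : nat * (T -> R),
    [/\ (n <= kX.1)%N, C kX.1 kX.2, phi kX.2 <= S + t n ^+ 2 & S - t n ^+ 2 <= J kX.1].
  have e0 : 0 < t n ^+ 2 by rewrite exprn_gt0.
  have supJ : has_sup (range J) by split => //; exists (J 0%N), 0%N.
  have [_ [m _ <-] Sm] := sup_adherent e0 supJ.
  pose k := maxn m n.
  have [_ [X CX <-] XJ] := inf_adherent e0 (conj (ne k) (lbJ k)).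
  exists (k, X); split => //=; first by rewrite leq_maxr.
    by apply: (le_trans (ltW XJ)); rewrite lerD2r JS.
  by apply: (le_trans (ltW Sm)); apply: Jmono; rewrite leq_maxl.
have [kX kXP] := choice choose_xi.
pose xi n := (kX n).2; exists xi; split.
  by move=> n; have [nk CX _ _] := kXP n; exact: Cdec CX.
pose h n w := expR (- (xi n w / 2)).
have Ck n : C (kX n).1 (xi n) by have [] := kXP n.
apply: (@ae_cvg_summable_mean h 3) => // [n|n]; first exact: mE (Ck n).
(* Both points, hence also their midpoint, lie in the larger set [C k], whose infimum is still at
   least [S - t n ^+ 2]. *)
pose k := minn (kX n).1 (kX n.+1).1.
have Cn : C k (xi n) by apply: Cdec (Ck n); exact: geq_minl.
have Cn1 : C k (xi n.+1) by apply: Cdec (Ck n.+1); exact: geq_minr.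
have tt : t n.+1 ^+ 2 <= t n ^+ 2 by rewrite lerXn2r ?nnegrE// ltW.
have kS : S - t n ^+ 2 <= J k.
  rewrite /k; have [_ _ _ Jn] := kXP n; have [_ _ _ Jn1] := kXP n.+1.
  case: leqP => _; [exact: Jn|apply: le_trans Jn1; rewrite lerD2l lerN2//].
have hh w : `|h n.+1 w - h n w| ^+ 2 = expR (- xi n w) + expR (- xi n.+1 w)
    - 2 * expR (- (2^-1 * (xi n w + xi n.+1 w))).
  rewrite real_normK ?num_real// sqrrB /h -!expRM_natl.
  rewrite -[X in _ - X]mulr_natl -expRD.
  have -> : - (xi n.+1 w / 2) + - (xi n w / 2) = - (2^-1 * (xi n w + xi n.+1 w)) by field.
  have -> a : 2%:R * - (a / 2) = - a :> R by field.
  have -> a : 2%:R * - (a / 2) = - a :> R by field.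
  by rewrite addrAC [in RHS](addrC (expR _)).
pose D w := `|h n.+1 w - h n w|.
have mh m : measurable_fun [set: T] (h m) by exact: mE (Ck m).
have h01 m w : 0 <= h m w <= 1 by exact: E01 (Ck m) _.
have mD : measurable_fun [set: T] D.
  by apply: measurableT_comp => //; exact: measurable_funB.
have D01 w : 0 <= D w <= 1.
  rewrite normr_ge0/= ler_norml.
  by have /andP[? ?] := h01 n w; have /andP[? ?] := h01 n.+1 w; apply/andP; split; lra.
have iD : P.-integrable [set: T] (EFin \o D) by exact: bounded_integrable01.
have iD2 : P.-integrable [set: T] (EFin \o (fun w => D w ^+ 2)).
  apply: bounded_integrable01; first exact: measurable_funX.
  by move=> w; have /andP[? ?] := D01 w; rewrite exprn_ge0 ?exprn_ile1.
rewrite -(EFin_Rintegral measurableT iD) lee_fin -/(t n).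
have mid := Cmid _ _ _ Cn Cn1.
(* Each endpoint has [phi] at most [S + t n ^+ 2] and the midpoint at least [S - t n ^+ 2], so [hh]
   bounds the mean by twice the difference. *)
have D2 : \int[P]_w (D w ^+ 2) <= 4 * t n ^+ 2.
  under eq_Rintegral do rewrite hh.
  have i1 := iE1 _ _ Cn; have i2 := iE1 _ _ Cn1; have i3 := iE1 _ _ mid.
  have i12 := integrableD measurableT i1 i2.
  have i4 := integrableZl measurableT 2 i3.
  rewrite RintegralB// RintegralD// RintegralZl//.
  have [_ _ x1 _] := kXP n; have [_ _ x2 _] := kXP n.+1.
  have := Jphi _ _ mid; rewrite /phi in x1 x2 *; rewrite -/(xi n) -/(xi n.+1) in x1 x2 *.
  by move=> x3; move: tt kS x1 x2 x3; lra.
(* The inequality 2ab <= a^2 + b^2 replaces Cauchy-Schwarz: the mean of [D] is at most 5/2 times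
   [t n], within the announced factor 3. *)
have : \int[P]_w (2 * t n * D w) <= \int[P]_w (t n ^+ 2 + D w ^+ 2).
  apply: le_Rintegral => //.
  - exact: (integrableZl measurableT (2 * t n) iD).
  - exact: (integrableD measurableT (finite_measure_integrable_cst P (t n ^+ 2) measurableT) iD2).
  - by move=> w _; have := sqr_ge0 (t n - D w); rewrite sqrrB; lra.
rewrite RintegralZl// RintegralD//; last exact: (finite_measure_integrable_cst P (t n ^+ 2)).
rewrite probability_Rintegral_cst => tD.
have : 2 * t n * \int[P]_w D w <= 2 * t n * (3 * t n).
  by apply: (le_trans tD); move: D2 (sqr_ge0 (t n)); lra.
by rewrite ler_pM2l// mulr_gt0.
Qed.

End convergence.

(** A positive limit can be inverted by the continuous map -2 ln; a zero limit forces [x] to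
    infinity. *)
Lemma cvg_expRN_half {R : realType} (x : nat -> R) :
  cvgn (fun n => expR (- (x n / 2))) ->
  (exists l : R, x @ \oo --> l) \/ (x @ \oo --> +oo).
Proof.
move=> /cvg_ex[l hl].
have l0 : 0 <= l.
  rewrite -(cvg_lim _ hl)//; apply: limr_ge; first exact: cvgP hl.
  by apply: nearW => n; exact: expR_ge0.
move: l0; rewrite le_eqVlt => /predU1P[l0|l0]; [right|left].
  apply/cvgryPge => A.
  have e0 : 0 < expR (- (A / 2)) by exact: expR_gt0.
  move: hl; rewrite -l0 => /cvgrPdist_lt /(_ _ e0).
  apply: filterS => n; rewrite sub0r normrN ger0_norm ?expR_ge0//.
  by rewrite ltr_expR; lra.
exists (- 2 * ln l).
have -> : x = (fun n => -2 * ln (expR (- (x n / 2)))).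
  by apply/funext => n; rewrite expRK; field.
apply: cvgMr; apply: (cvg_comp _ _ hl); exact: continuous_ln.
Qed.

Lemma cvg_minr_cst {R : realType} (x : nat -> R) (l c : R) : x @ \oo --> l ->
  (fun n => Num.min (x n) c) @ \oo --> Num.min l c.
Proof.
move=> xl.
under eq_fun do rewrite minr_absE.
rewrite minr_absE.
apply: cvgMl; apply: cvgB; first by apply: cvgD => //; exact: cvg_cst.
by apply: cvg_norm; apply: cvgB => //; exact: cvg_cst.
Qed.

(** * Passage to the limit: convergence in probability, Fatou's lemma, uniform integrability *)

Section limits.
Context {d : measure_display} {T : measurableType d} {R : realType}.
Variable P : probability T R.
Implicit Types (X Y : T -> R) (xi : nat -> T -> R).

(** The indicators of the deviation events tend to 0 almost surely and are bounded by 1, so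
    dominated convergence applies. *)
Lemma ae_cvg_in_probability xi X :
  (forall n, measurable_fun [set: T] (xi n)) -> measurable_fun [set: T] X ->
  (\forall w \ae P, xi ^~ w @ \oo --> X w) -> cvg_in_probability P xi X.
Proof.
move=> mxi mX cxi e e0.
pose A n := [set w | e < `|xi n w - X w|].
have mA n : measurable (A n).
  have mD : measurable_fun [set: T] (fun w => `|xi n w - X w|).
    by apply: measurableT_comp => //; exact: measurable_funB.
  rewrite (_ : A n = [set: T] `&` (fun w => `|xi n w - X w|) @^-1` `]e, +oo[%classic).
    exact: mD.
  by rewrite setTI; apply/seteqP; split => w; rewrite /A/= in_itv/= andbT.
have c1 : \forall w \ae P, [set: T] w ->
    (fun n => (\1_(A n) w)%:E : \bar R) @ \oo --> (cst 0%E w : \bar R).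
  apply: filterS cxi => w /cvgrPdist_le/(_ _ e0) cw _.
  apply: cvg_near_cst; apply: filterS cw => n nw.
  rewrite indicE memNset//= /A/=; apply/negP; by rewrite -leNgt distrC.
have c2 : P.-integrable setT (cst 1%E) by exact: (finite_measure_integrable_cst P 1).
have c3 : \forall w \ae P, forall n, [set: T] w -> (`|(\1_(A n) w)%:E| <= (cst 1%E w : \bar R))%E.
  by apply: aeW => w n _; rewrite lee_fin indicE; case: (_ \in _); rewrite ?normr1 ?normr0.
have mI n : measurable_fun [set: T] (fun w => (\1_(A n) w)%:E : \bar R).
  exact: measurable_int (integrable_indic P (mA n)).
have [_ _] := dominated_convergence measurableT mI (measurable_cst _) c1 c2 c3.
rewrite integral0.
by under eq_fun do rewrite integral_indic// setIT.
Qed.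

Lemma fatou_cst (f : nat -> T -> \bar R) (c : \bar R) :
  (forall n, measurable_fun [set: T] (f n)) -> (forall n w, (0 <= f n w)%E) ->
  (forall n, \int[P]_w f n w <= c)%E ->
  (\int[P]_w limn_einf (f ^~ w) <= c)%E.
Proof.
move=> mf f0 fc; have /le_trans := fatou P measurableT mf (fun n w _ => f0 n w); apply.
rewrite limn_einf_lim; apply: lime_le; first exact: is_cvg_einfs.
apply: nearW => n; apply: le_trans (fc n).
by apply: ereal_inf_lbound; exists n => /=.
Qed.

Lemma measurable_limn_einf (f : nat -> T -> \bar R) :
  (forall n, measurable_fun [set: T] (f n)) ->
  measurable_fun [set: T] (fun w => limn_einf (f ^~ w)).
Proof.
move=> mf; rewrite /limn_einf; apply: measurableT_comp => //.
apply: (@measurable_fun_limn_esup _ T R setT (fun n w => - f n w)%E) => n.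
exact: measurableT_comp.
Qed.

Lemma limn_einf_ge0 (u : nat -> \bar R) :
  (forall n, (0 <= u n)%E) -> (0 <= limn_einf u)%E.
Proof.
move=> u0; rewrite limn_einf_lim; apply: lime_ge; first exact: is_cvg_einfs.
apply: nearW => n; apply: le_ereal_inf_tmp => _ [m _ <-]; exact: u0.
Qed.

(* Fatou's lemma excludes the value [+oo] for the limit. *)
Lemma ae_cvg_of_expR xi (c : R) :
  (forall n, measurable_fun [set: T] (xi n)) -> (forall n w, 0 <= xi n w) ->
  (forall n, \int[P]_w (xi n w)%:E <= c%:E)%E ->
  (\forall w \ae P, cvgn (fun n => expR (- (xi n w / 2)))) ->
  exists X, [/\ measurable_fun [set: T] X, forall w, 0 <= X w &
    \forall w \ae P, xi ^~ w @ \oo --> X w].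
Proof.
move=> mxi xi0 xic cxi.
pose f n w := (xi n w)%:E; pose L w := limn_einf (f ^~ w).
have mf n : measurable_fun [set: T] (f n) by exact/measurable_EFinP.
have f0 n w : (0 <= f n w)%E by rewrite lee_fin.
have mL : measurable_fun [set: T] L by exact: measurable_limn_einf.
have L0 w : (0 <= L w)%E by exact: limn_einf_ge0.
have iL : P.-integrable [set: T] L.
  apply/integrableP; split => //; apply: (@le_lt_trans _ _ c%:E); last exact: ltry.
  under eq_integral do rewrite gee0_abs//.
  exact: fatou_cst.
(* [fine] sends [+oo] to 0, which alters [L] only on a null set and keeps the limit real and
   nonnegative everywhere. *)
exists (fine \o L); split.
- exact: measurableT_comp.
- by move=> w; exact: fine_ge0.
have := integrable_ae measurableT iL.
apply: filterS2 cxi => w /cvg_expRN_half + /(_ Logic.I); rewrite /L => -[[l xl]|xoo].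
  have fl : f ^~ w @ \oo --> l%:E by apply: cvg_EFin => //; exact: nearW.
  by have [e _] := cvg_limn_einf_sup fl; rewrite /= /L e.
have fl : f ^~ w @ \oo --> +oo%E by apply/cvgeryP.
by have [e _] := cvg_limn_einf_sup fl; rewrite /= /L e.
Qed.

(** Fatou's lemma gives mean at most 1. Conversely, truncation at a level [c] costs at most [e]
    uniformly in [n], and the truncated means converge by dominated convergence. *)
Lemma uniformly_integrable_lim (A : set (T -> R)) xi X :
  uniformly_integrable P A -> (forall n, A (xi n)) ->
  (forall n, P.-integrable [set: T] (EFin \o xi n)) ->
  (forall n w, 0 <= xi n w) -> (forall n, \int[P]_w xi n w = 1) ->
  measurable_fun [set: T] X -> (forall w, 0 <= X w) ->
  (\forall w \ae P, xi ^~ w @ \oo --> X w) ->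
  P.-integrable [set: T] (EFin \o X) /\ \int[P]_w X w = 1.
Proof.
move=> UI Axi ixi xi0 xi1 mX X0 cxi.
pose f n w := (xi n w)%:E.
have mxi n : measurable_fun [set: T] (xi n).
  by apply/measurable_EFinP/(measurable_int P).
have mf n : measurable_fun [set: T] (f n) by exact/measurable_EFinP.
have f0 n w : (0 <= f n w)%E by rewrite lee_fin.
have f1 n : (\int[P]_w f n w = 1%:E)%E by rewrite -EFin_Rintegral// xi1.
have X1 : (\int[P]_w (X w)%:E <= 1%:E)%E.
  rewrite (@ge0_ae_eq_integral _ _ _ _ _ _ (fun w => limn_einf (f ^~ w)))//.
  - by apply: fatou_cst => // n; rewrite f1.
  - exact/measurable_EFinP.
  - exact: measurable_limn_einf.
  - by move=> w _; rewrite lee_fin.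
  - by move=> w _; exact: limn_einf_ge0.
  - apply: filterS cxi => w xl _.
    have fl : f ^~ w @ \oo --> (X w)%:E by apply: cvg_EFin => //; exact: nearW.
    by have [-> _] := cvg_limn_einf_sup fl.
have iX : P.-integrable [set: T] (EFin \o X).
  apply/integrableP; split; first exact/measurable_EFinP.
  under eq_integral do rewrite gee0_abs ?lee_fin//.
  exact: le_lt_trans X1 (ltry _).
split => //; apply/eqP; rewrite eq_le -lee_fin EFin_Rintegral// X1/=.
apply/ler_addgt0Pr => e e0.
have [c [c0 ce]] : exists c : R, 0 < c /\
    forall n, (\int[P]_(w in [set w | (c < xi n w)%R]) (xi n w)%:E <= e%:E)%E.
  pose u (c : R) : \bar R := ereal_sup
    [set (\int[P]_(w in [set w | (c < `|Y w|)%R]) `|Y w|%:E)%E | Y in A].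
  have [ufin u0] := (fine_cvgP u 0).1 UI.
  have [c c0 [cfin ce]] := pinfty_ex_gt0 (filterI ufin (cvgr_lt _ u0 _ e0)).
  have cU : (u c < e%:E)%E by rewrite -[u c]fineK.
  exists c; split => // n; apply: le_trans (ltW cU).
  apply: ereal_sup_ubound; exists (xi n) => //.
  rewrite (_ : [set w | c < `|xi n w|] = [set w | c < xi n w]); last first.
    by apply/seteqP; split => w /=; rewrite ger0_norm.
  by apply: eq_integral => w _; rewrite ger0_norm.
pose g n w := (Num.min (xi n w) c)%:E; pose g' w := (Num.min (X w) c)%:E.
have mg n : measurable_fun [set: T] (g n).
  by apply/measurable_EFinP; exact: measurable_minr.
have mg' : measurable_fun [set: T] g'.
  by apply/measurable_EFinP; exact: measurable_minr.
have g0 n w : (0 <= g n w)%E by rewrite lee_fin le_min xi0 ltW.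
have g'0 w : (0 <= g' w)%E by rewrite lee_fin le_min X0 ltW.
have mc n : measurable [set w | c < xi n w].
  rewrite (_ : mkset _ = [set: T] `&` (xi n) @^-1` `]c, +oo[%classic).
    exact: mxi.
  by rewrite setTI; apply/seteqP; split => w; rewrite /= in_itv/= andbT.
(* Pointwise, [xi n] is at most its truncation plus its own restriction to the event where it
   exceeds [c]. *)
have cX n : (1%:E <= \int[P]_w g n w + e%:E)%E.
  rewrite -(f1 n); apply: le_trans (leeD2l _ (ce n)).
  rewrite [X in (_ + X)%E]integral_mkcond -ge0_integralD//; last 2 first.
  - by move=> w _; rewrite patchE; case: ifP => _ //; rewrite lee_fin.
  - by apply: (measurable_restrictT _ (mc n)).1; exact: measurable_funTS (mf n).
  apply: ge0_le_integral => //.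
  - apply: emeasurable_funD => //.
    by apply: (measurable_restrictT _ (mc n)).1; exact: measurable_funTS (mf n).
  - move=> w _; rewrite /f /g patchE; case: ifPn => [_|/negP wc].
      by rewrite -EFinD lee_fin lerDr le_min xi0 ltW.
    rewrite adde0 lee_fin le_min lexx/= leNgt; apply/negP => cw.
    by apply: wc; rewrite inE.
have gl : (fun n => \int[P]_w g n w)%E @ \oo --> (\int[P]_w g' w)%E.
  have c1 : \forall w \ae P, [set: T] w -> g ^~ w @ \oo --> g' w.
    apply: filterS cxi => w xl _; apply: cvg_EFin; first exact: nearW.
    exact: cvg_minr_cst.
  have c2 := finite_measure_integrable_cst P c measurableT.
  have c3 : \forall w \ae P, forall n, [set: T] w -> (`|g n w| <= c%:E)%E.
    by apply: aeW => w n _; rewrite gee0_abs// lee_fin ge_min lexx orbT.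
  by have [] := dominated_convergence measurableT mg mg' c1 c2 c3.
have gX : (\int[P]_w g' w <= \int[P]_w (X w)%:E)%E.
  apply: ge0_le_integral => //; first exact/measurable_EFinP.
  by move=> w _; rewrite lee_fin ge_min lexx.
rewrite -lee_fin EFinD EFin_Rintegral//.
apply: le_trans (leeD2r _ gX).
have gel : (fun n => \int[P]_w g n w + e%:E)%E @ \oo --> (\int[P]_w g' w + e%:E)%E.
  by apply: cvgeD gl (cvg_cst _); rewrite fin_num_adde_defl.
by apply: (cvge_ge _ gel); exact: nearW.
Qed.

End limits.

(** * Superhedging relations as integral inequalities *)

Section superhedging.
Context {d : measure_display} {T : measurableType d} {R : realType}.
Variables (F : nat -> set (set T)) (M : set (probability T R)).
Hypothesis filtF : filtration F.
Implicit Types (P : probability T R) (X xi : T -> R).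

Lemma filtration_sigma m : sigma_algebra [set: T] (F m).
Proof. by have [+ _ _] := filtF. Qed.

Lemma filtration_measurable m : F m `<=` measurable.
Proof. by have [_ _ +] := filtF. Qed.

Lemma filtrationS m n : (m <= n)%N -> F m `<=` F n.
Proof.
have [_ FS _] := filtF.
elim: n => [|n IH]; first by rewrite leqn0 => /eqP ->.
rewrite leq_eqVlt ltnS => /predU1P[->//|/IH Fmn].
exact: subset_trans (FS n).
Qed.

Lemma Rintegral_condexp P m X A : P.-integrable [set: T] (EFin \o X) -> F m A ->
  \int[P]_(w in A) condexp P (F m) X w = \int[P]_(w in A) X w.
Proof.
move=> iX FA; congr fine.
by have [_ _ ->] := condexpP (filtration_sigma m) (@filtration_measurable m) iX.
Qed.

Lemma A0P xi : A0 M xi <->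
  [/\ forall w, 0 <= xi w, integrable_all M xi &
      forall P, M P -> \int[P]_w xi w = 1].
Proof.
split=> -[xi0 ixi E1]; split => // P MP.
  by apply/(Rintegral_expectation _ (ixi P MP)); rewrite E1.
by apply/(Rintegral_expectation _ (ixi P MP)); rewrite E1.
Qed.

(* Testing against the events of [F N] turns the superhedging relation into
   inequalities that are affine in [alpha] and [xi]. *)
Lemma superhedgesP N X alpha xi :
  measurable_wrt (F N) X -> integrable_all M X -> integrable_all M xi ->
  superhedges F M N X alpha xi <->
  forall P, M P -> forall A, F N A ->
    \int[P]_(w in A) X w <= alpha * \int[P]_(w in A) xi w.
Proof.
move=> mX iX ixi.
suff PE P : M P ->
    P [set w | X w - alpha * condexp P (F N) xi w <= 0] = 1%E <->
    forall A, F N A -> \int[P]_(w in A) X w <= alpha * \int[P]_(w in A) xi w.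
  by split=> H P MP; apply/PE => //; exact: H.
move=> MP; have sF := filtration_sigma N; have FT := @filtration_measurable N.
have [mY iY _] := condexpP sF FT (ixi P MP).
set Y := condexp P (F N) xi in mY iY *.
have maY : measurable_wrt (F N) (fun w => alpha * Y w).
  exact: measurable_funM.
have iaY : P.-integrable [set: T] (EFin \o (fun w => alpha * Y w)).
  exact: (integrableZl measurableT alpha iY).
have -> : (forall A, F N A -> \int[P]_(w in A) X w <= alpha * \int[P]_(w in A) xi w)
    <-> (forall A, F N A -> \int[P]_(w in A) X w <= \int[P]_(w in A) (alpha * Y w)).
  have aE A : F N A -> \int[P]_(w in A) (alpha * Y w) = alpha * \int[P]_(w in A) xi w.
    move=> FA; rewrite RintegralZl ?Rintegral_condexp//; [exact: ixi|exact: FT|].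
    exact: integrableS (FT _ FA) _ iY.
  by split=> H A FA; have := H A FA; rewrite aE.
rewrite (ae_le_measurable_wrt sF FT mX maY (iX P MP) iaY).
rewrite (ae_probability_eq1 P); last first.
  rewrite (_ : mkset _ = (fun w => X w - alpha * Y w) @^-1` `]-oo, 0]%classic).
    by apply: FT; apply: measurable_wrt_preimage => //; exact: measurable_funB.
  by apply/seteqP; split => w; rewrite /= in_itv.
by split; apply: filterS => w /=; rewrite subr_le0.
Qed.

Lemma integrable_all_measurable X : M !=set0 -> integrable_all M X ->
  measurable_fun [set: T] X.
Proof. by move=> [P MP] /(_ P MP)/(measurable_int P)/measurable_EFinP. Qed.

(** * The price set of a fixed claim and existence of the fair price *)

Section market.
Variables (N : nat) (X : T -> R).
Hypotheses (mX : measurable_wrt (F N) X) (iX : integrable_all M X).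

Lemma superhedges_le alpha beta xi : A0 M xi -> alpha <= beta ->
  superhedges F M N X alpha xi -> superhedges F M N X beta xi.
Proof.
move=> [xi0 ixi _] ab /(superhedgesP _ mX iX ixi) H.
apply/(superhedgesP _ mX iX ixi) => P MP A FA; apply: le_trans (H P MP A FA) _.
by rewrite ler_wpM2r// Rintegral_ge0.
Qed.

(** Midpoints are all the convexity that [ae_cvg_convex] asks for; the integral form of superhedging
    is affine in [xi]. *)
Lemma A0_superhedges_midpoint alpha xi1 xi2 :
  A0 M xi1 /\ superhedges F M N X alpha xi1 ->
  A0 M xi2 /\ superhedges F M N X alpha xi2 ->
  let xi w := 2^-1 * (xi1 w + xi2 w) in
  A0 M xi /\ superhedges F M N X alpha xi.
Proof.
move=> [/A0P[p1 i1 e1] s1] [/A0P[p2 i2 e2] s2] xi.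
have i12 P A : M P -> measurable A -> P.-integrable A (EFin \o (fun w => xi1 w + xi2 w)).
  move=> MP mA; apply: (integrableS measurableT) => //.
  exact: (integrableD measurableT (i1 P MP) (i2 P MP)).
have xiE P A : M P -> measurable A -> \int[P]_(w in A) xi w =
    2^-1 * (\int[P]_(w in A) xi1 w + \int[P]_(w in A) xi2 w).
  move=> MP mA; rewrite RintegralZl ?RintegralD//; last exact: i12.
  - by apply: (integrableS measurableT) => //; exact: i1.
  - by apply: (integrableS measurableT) => //; exact: i2.
have ixi : integrable_all M xi.
  by move=> P MP; exact: (integrableZl measurableT _ (i12 P _ MP measurableT)).
split.
  apply/A0P; split => // [w|P MP].
    by rewrite mulr_ge0// addr_ge0.
  by rewrite xiE// e1// e2//; field.
apply/(superhedgesP _ mX iX ixi) => P MP A FA.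
have mA := @filtration_measurable N A FA.
have := (superhedgesP _ mX iX i1).1 s1 P MP A FA.
have := (superhedgesP _ mX iX i2).1 s2 P MP A FA.
by rewrite xiE//; lra.
Qed.

Lemma price_set_lbound alpha0 : has_lbound (price_set F M N X alpha0).
Proof. by exists 0 => a [/andP[]]. Qed.

(** Almost sure convergence is obtained under one measure and carried to the others by equivalence;
    uniform integrability is then applied under each measure separately. *)
Lemma fair_price_exists alpha0 :
  M !=set0 -> equivalent_measures M ->
  (forall P, M P -> uniformly_integrable P (A0 M)) ->
  price_set F M N X alpha0 !=set0 ->
  is_fair_price F M N X alpha0 (inf (price_set F M N X alpha0)).
Proof.
move=> M0 M_equiv UI G0; set G := price_set F M N X alpha0 in G0 *.
split => //; set f0 := inf G.
have Glb : has_lbound G := @price_set_lbound alpha0.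
have f0_ge0 : 0 <= f0 by apply: lb_le_inf => // a [/andP[]].
have f0_le : f0 <= alpha0.
  by have [a Ga] := G0; apply: le_trans (ge_inf Glb Ga) _; have [/andP[]] := Ga.
(* Capping at [alpha0] keeps the prices admissible and does not change the limit, since
   [f0 <= alpha0]. *)
pose alpha n := Num.min (f0 + n.+1%:R^-1) alpha0.
have alphaS m n : (m <= n)%N -> alpha n <= alpha m.
  move=> mn; rewrite /alpha le_min !ge_min lexx orbT andbT.
  by rewrite lerD2l lef_pV2 ?posrE// ler_nat ltnS mn.
pose C n := [set xi | A0 M xi /\ superhedges F M N X (alpha n) xi].
have [P MP] := M0.
have Cmeas n xi : C n xi -> measurable_fun [set: T] xi.
  by move=> [[_ ixi _] _]; exact: integrable_all_measurable.
have Cne n : C n !=set0.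
  have n0 : 0 < n.+1%:R^-1 :> R by [].
  have [a [/andP[a0 aa0] [xi A0xi axi]] af] := inf_adherent n0 (conj G0 Glb).
  exists xi; split => //; apply: superhedges_le axi => //.
  by rewrite /alpha le_min aa0 ltW.
have Cdec m n : (m <= n)%N -> C n `<=` C m.
  by move=> mn xi [A0xi sxi]; split => //; apply: superhedges_le sxi => //; exact: alphaS.
have Cge0 n xi w : C n xi -> 0 <= xi w by move=> [[]].
have Cmid n xi1 xi2 : C n xi1 -> C n xi2 -> C n (fun w => 2^-1 * (xi1 w + xi2 w)).
  exact: A0_superhedges_midpoint.
have [xi [Cxi cvg_exp]] := ae_cvg_convex P Cne Cdec Cmeas Cge0 Cmid.
have A0xi n : A0 M (xi n) by have [] := Cxi n.
have mxi n : measurable_fun [set: T] (xi n) := Cmeas _ _ (Cxi n).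
have xi0 n w : 0 <= xi n w by exact: Cge0 (Cxi n).
have ixi n : integrable_all M (xi n) by have [] := A0xi n.
have xi1 n Q : M Q -> \int[Q]_w xi n w = 1.
  by have /A0P[_ _] := A0xi n; apply.
have [|zeta [mzeta zeta0 cvgP]] := ae_cvg_of_expR (c := 1) mxi xi0 _ cvg_exp.
  by move=> n; rewrite -EFin_Rintegral ?xi1//; exact: ixi.
(* The exceptional null set of [P] is also null under [Q]. *)
have cvg_zeta Q : M Q -> \forall w \ae Q, xi ^~ w @ \oo --> zeta w.
  move=> MQ; have [B [mB PB0 cB]] := cvgP; exists B; split => //.
  by apply: (null_content_dominatesP _ _).1 PB0 => //; exact: M_equiv.
have zetaP Q : M Q -> Q.-integrable [set: T] (EFin \o zeta) /\ \int[Q]_w zeta w = 1.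
  move=> MQ; apply: (uniformly_integrable_lim (UI Q MQ) A0xi) => //.
  - by move=> n; exact: ixi.
  - by move=> n; exact: xi1.
  - exact: cvg_zeta.
exists zeta, alpha, xi; split.
- by apply/A0P; split => // Q MQ; have [] := zetaP Q MQ.
- move=> n; split; last by have [] := A0xi n.
  by rewrite /alpha le_min ge_min lexx orbT !andbT addr_ge0//= (le_trans f0_ge0).
- rewrite -[X in _ --> X](min_l f0_le); apply: cvg_minr_cst.
  rewrite -[X in _ --> X]addr0; apply: cvgD; first exact: cvg_cst.
  exact: cvg_harmonic.
- by move=> Q MQ; apply: ae_cvg_in_probability => //; exact: cvg_zeta.
- by move=> n; have [] := Cxi n.
Qed.

(** Superhedging is tested on the whole space, where [xi] has mean 1. *)
Lemma price_set_expectation_le alpha0 alpha P :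
  price_set F M N X alpha0 alpha -> M P -> \int[P]_w X w <= alpha.
Proof.
move=> [_ [xi A0xi sxi]] MP; have /A0P[_ ixi xi1] := A0xi.
have := (superhedgesP _ mX iX ixi).1 sxi P MP setT.
rewrite xi1// mulr1; apply.
have [F0 FC _] := filtration_sigma N.
by rewrite -(setD0 [set: T]); exact: FC.
Qed.

End market.
End superhedging.

(** * Compensators of regular supermartingales *)

Section regularity.
Context {d : measure_display} {T : measurableType d} {R : realType}.
Implicit Types (P : probability T R) (X : T -> R).

Lemma Radon_Nikodym_self P :
  \forall w \ae P, Radon_Nikodym (charge_of_finite_measure P) P w = 1%E.
Proof.
have PP : charge_of_finite_measure P `<< P by [].
have iRN := Radon_Nikodym_integrable PP.
have : ae_eq P [set: T] (Radon_Nikodym (charge_of_finite_measure P) P) (cst 1%E).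
  apply: integral_ae_eq => // A _ mA.
  by rewrite -(Radon_Nikodym_integral PP mA) integral_cst// mul1e.
by apply: filterS => w; apply.
Qed.

(** This makes one-measure families admissible in the definition of regularity, with [l = L = 1]. *)
Lemma comparable_densities_cst P : comparable_densities (fun _ : 'I_1 => P).
Proof.
exists 1, 1; split => // _ _; apply: filterS (Radon_Nikodym_self P) => w ->.
by rewrite lexx.
Qed.

Lemma mixtures_cst P : mixtures (fun _ : 'I_1 => P) P.
Proof.
exists (fun=> 1); split => //; first by rewrite big_ord1.
by move=> B mB; rewrite big_ord1 mul1e.
Qed.

(** The level set through any point is a nonempty event of [G], hence the whole space. *)
Lemma measurable_wrt_trivial (G : set (set T)) X :
  sigma_algebra [set: T] G -> G `<=` [set set0; [set: T]] ->
  measurable_wrt G X -> exists c, X = cst c.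
Proof.
move=> sG G01 mX; have [[w _]|T0] := pselect ([set: T] !=set0); last first.
  by exists 0; apply/funext => w; case: T0; exists w.
exists (X w); apply/funext => v.
have [E|E] := G01 _ (measurable_wrt_preimage sG mX (measurable_set1 (X w))).
  by have : set0 w by rewrite -E.
by have : [set: T] v by []; rewrite -E.
Qed.

Lemma ae_eq_Rintegral P X Y (A : set T) : measurable A ->
  P.-integrable [set: T] (EFin \o X) -> P.-integrable [set: T] (EFin \o Y) ->
  (\forall w \ae P, X w = Y w) -> \int[P]_(w in A) X w = \int[P]_(w in A) Y w.
Proof.
move=> mA iX iY XY; apply/eqP; rewrite eq_le !ae_le_Rintegral//;
  by apply: filterS XY => w ->.
Qed.

Variables (F : nat -> set (set T)) (M : set (probability T R)).
Hypotheses (filtF : filtration F) (F0 : F 0%N = [set set0; [set: T]]).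

Let setT_F m : F m [set: T].
Proof.
have [FS0 FC _] := filtration_sigma filtF m.
by rewrite -(setD0 [set: T]); exact: FC.
Qed.

(** The definition asks for integrability from time 1 on; at time 0 the value is a constant because
    [F 0] is trivial. *)
Lemma supermartingale_integrable f m : supermartingale F M f ->
  integrable_all M (f m).
Proof.
move=> [fad fi _] P MP; case: m => [|m]; last exact: fi.
have [|c ->] := measurable_wrt_trivial (filtration_sigma filtF 0%N) _ (fad 0%N).
  by rewrite F0.
exact: finite_measure_integrable_cst.
Qed.

(* Families reduced to a single measure suffice: since [gbar] does not depend
   on the family, it compensates [f] in mean under every measure of [M]. *)
Lemma regular_compensator f : regular_supermartingale F M f ->
  exists gbar : nat -> T -> R,
    [/\ adapted F gbar, forall m w, 0 <= gbar m w,
        forall m, integrable_all M (gbar m.+1) &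
        forall P m, M P ->
          \int[P]_w f m.+1 w + \int[P]_w gbar m.+1 w = \int[P]_w f m w].
Proof.
move=> [smf _ [gbar [gad g0 _ gi greg]]]; exists gbar; split => //.
  by move=> m; exact: gi.
move=> P m MP.
have [_ [C [g [[CS _ _] [Cg _] gmart gcomp]]]] :=
  greg 0%N (fun=> P) (fun=> MP) (comparable_densities_cst P).
have [gada gz _ smfg] := CS _ Cg.
have fI n : P.-integrable [set: T] (EFin \o f n) by exact: supermartingale_integrable MP.
have fgI n : P.-integrable [set: T] (EFin \o (fun w => f n w + g n w)).
  case: n => [|n]; last by have [_ + _] := smfg; apply => //; exact: mixtures_cst.
  under [X in EFin \o X]eq_fun do rewrite gz addr0.
  exact: fI.
have gI n : P.-integrable [set: T] (EFin \o g n).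
  have := integrableB measurableT (fgI n) (fI n).
  by apply: eq_integrable => // w _ /=; rewrite -EFinB addrAC subrr add0r.
have gBI : P.-integrable [set: T] (EFin \o (fun w => g m.+1 w - g m w)).
  exact: (integrableB measurableT (gI _) (gI _)).
have cI k X : P.-integrable [set: T] (EFin \o X) ->
    P.-integrable [set: T] (EFin \o condexp P (F k) X).
  by move=> /(condexpP (filtration_sigma filtF k) (@filtration_measurable _ _ _ filtF k))[].
(* Integrating the martingale identity over the whole space shows that [f + g] has constant mean;
   [e2] then trades the increment of [g] for [gbar]. *)
have e1 : \int[P]_w f m.+1 w + \int[P]_w g m.+1 w = \int[P]_w f m w + \int[P]_w g m w.
  rewrite -!RintegralD// -(Rintegral_condexp filtF (fgI m.+1) (setT_F m)).
  apply: ae_eq_Rintegral => //; first exact: cI.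
  exact: (gmart m m.+1 ord0).
have e2 : \int[P]_w g m.+1 w - \int[P]_w g m w = \int[P]_w gbar m.+1 w.
  have gbI : P.-integrable [set: T] (EFin \o gbar m.+1) by exact: gi.
  rewrite -RintegralB// -(Rintegral_condexp filtF gBI (setT_F m)).
  rewrite -(Rintegral_condexp filtF gbI (setT_F m)).
  apply: ae_eq_Rintegral => //; [exact: cI|exact: cI|].
  exact: (gcomp m.+1 ord0).
by rewrite -e2; lra.
Qed.

(** [G] is the sum of [gbar] over the times 1 to [n]; the one-step mean identities telescope. *)
Lemma regular_compensator_sum f n : regular_supermartingale F M f ->
  exists G : T -> R,
    [/\ measurable_wrt (F n) G, forall w, 0 <= G w, integrable_all M G &
        forall P, M P -> \int[P]_w f n w + \int[P]_w G w = \int[P]_w f 0%N w].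
Proof.
move=> /regular_compensator[gbar [gad g0 gi ge]].
elim: n => [|n [G [mG G0 iG GE]]].
  exists (cst 0); split => //; first exact: measurable_cst.
    by move=> P _; exact: finite_measure_integrable_cst.
  by move=> P _; rewrite probability_Rintegral_cst addr0.
exists (fun w => G w + gbar n.+1 w); split.
- apply: measurable_funD; last exact: gad.
  apply: measurable_wrtS mG; [exact: filtration_sigma|exact: filtration_sigma|].
  exact: filtrationS.
- by move=> w; rewrite addr_ge0.
- by move=> P MP; exact: (integrableD measurableT (iG P MP) (gi n P MP)).
- move=> P MP; rewrite RintegralD//; [|exact: iG|exact: gi].
  by rewrite -GE// -(ge P n MP); lra.
Qed.

Lemma condexp_id P m X : measurable_wrt (F m) X ->
  P.-integrable [set: T] (EFin \o X) ->
  \forall w \ae P, condexp P (F m) X w = X w.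
Proof.
move=> mX iX; have sF := filtration_sigma filtF m.
have FT : F m `<=` measurable by exact: filtration_measurable.
have [mY iY _] := condexpP sF FT iX.
have eA A : F m A -> \int[P]_(w in A) condexp P (F m) X w = \int[P]_(w in A) X w.
  exact: Rintegral_condexp.
have := (ae_le_measurable_wrt sF FT mX mY iX iY).1 (fun A FA => ltac:(by rewrite eA)).
have := (ae_le_measurable_wrt sF FT mY mX iY iX).1 (fun A FA => ltac:(by rewrite eA)).
by apply: filterS2 => w ? ?; apply/eqP; rewrite eq_le; apply/andP.
Qed.

(** If [Q] failed, the exceptional null set would be the whole space, which has probability one. *)
Lemma ae_cst P (Q : Prop) : (\forall w \ae P, Q) -> Q.
Proof.
move=> [B [_ PB0 QB]]; apply: contrapT => nQ.
have BT : B = [set: T] by apply/seteqP; split => // w _; exact: QB.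
have := probability_setT P; rewrite -BT [LHS]PB0 => /eqP.
by rewrite eq_sym onee_eq0.
Qed.

Lemma ae_equivalent P (E : T -> Prop) : equivalent_measures M -> M P ->
  (\forall w \ae P, E w) -> ae_all M E.
Proof.
move=> M_equiv MP [B [mB PB0 EB]] Q MQ; exists B; split => //.
by apply: (null_content_dominatesP _ _).1 PB0 => //; exact: M_equiv.
Qed.

(** * The essential supremum process at times [N] and 0, and its initial value as a price *)

Section ess_sup_process.
Variables (N : nat) (X : T -> R) (f : nat -> T -> R).
Hypotheses (M_equiv : equivalent_measures M) (M0 : M !=set0).
Hypotheses (mX : measurable_wrt (F N) X) (iX : integrable_all M X).
Hypothesis ess_f : forall m, is_ess_sup M [set condexp P (F m) X | P in M] (f m).

(** At time [N] every conditional expectation in the family is a version of [X] itself. *)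
Lemma ess_sup_terminal : ae_all M (fun w => f N w = X w).
Proof.
have [P0 MP0] := M0; have [_ ub lub] := ess_f N.
have cX P : M P -> ae_all M (fun w => condexp P (F N) X w = X w).
  by move=> MP; apply: (ae_equivalent M_equiv MP); apply: condexp_id => //; exact: iX.
have XT : measurable_fun [set: T] X.
  by apply: measurable_wrt_fun mX; [exact: filtration_sigma|exact: filtration_measurable].
have fX : ae_all M (fun w => f N w <= X w).
  apply: lub => // _ [P MP <-] Q MQ.
  by have := cX P MP Q MQ; apply: filterS => w ->.
have Xf : ae_all M (fun w => condexp P0 (F N) X w <= f N w) by apply: ub; exists P0.
move=> Q MQ; have := Xf Q MQ; have := cX P0 MP0 Q MQ; have := fX Q MQ.
by apply: filterS3 => w ? -> ?; apply/eqP; rewrite eq_le; apply/andP.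
Qed.

(** Conditional expectations at time 0 are the constants [E^P X], so the essential supremum [c] is
    the least upper bound of these means. *)
Lemma ess_sup_initial : measurable_wrt (F 0%N) (f 0%N) -> exists c,
  [/\ f 0%N = cst c, forall P, M P -> \int[P]_w X w <= c &
      forall b, (forall P, M P -> \int[P]_w X w <= b) -> c <= b].
Proof.
have sF := filtration_sigma filtF 0%N.
have F0s : F 0%N `<=` [set set0; [set: T]] by rewrite F0.
move=> mf0; have [c fc] := measurable_wrt_trivial sF F0s mf0.
have [P0 MP0] := M0; have [_ ub lub] := ess_f 0%N.
have cE P : M P -> condexp P (F 0%N) X = cst (\int[P]_w X w).
  move=> MP; have iXP := iX MP.
  have [mY _ _] := condexpP sF (@filtration_measurable _ _ _ filtF 0%N) iXP.
  have [a aE] := measurable_wrt_trivial sF F0s mY.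
  by rewrite -(Rintegral_condexp filtF iXP (setT_F 0%N)) aE probability_Rintegral_cst.
exists c; split => // [P MP|b Xb].
  apply: (@ae_cst P); have : ae_all M (fun w => condexp P (F 0%N) X w <= f 0%N w).
    by apply: ub; exists P.
  by move=> /(_ P MP); rewrite cE// fc.
apply: (@ae_cst P0); have : ae_all M (fun w => f 0%N w <= cst b w).
  apply: lub; first exact: measurable_cst.
  by move=> _ [P MP <-] Q MQ; apply: aeW => w; rewrite cE// Xb.
by move=> /(_ P0 MP0); rewrite fc.
Qed.

(* With [X + G] the terminal value of the martingale part of [f] and [c] its
   initial value, [xi = (X + G) / c] superhedges [X] at the price [c]. *)
Lemma price_set_initial alpha0 xi0 c : A0 M xi0 ->
  superhedges F M N X alpha0 xi0 -> (forall w, 0 <= X w) ->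
  local_regular_supermartingale F M f -> f 0%N = cst c -> 0 <= c <= alpha0 ->
  price_set F M N X alpha0 c.
Proof.
move=> A0xi0 sxi0 X0 [_ _ [k [_ koo kreg]]] fc /andP[c0 calpha0].
(* Stopping at a time not before [N] leaves the value at time [N] unchanged. *)
have [s Nks] : exists s, (N <= k s)%N.
  have /cvgnyPge/(_ N)[s _ ks] := koo.
  by exists s; apply: ks => /=.
have [G [mG G0 iG GE]] := regular_compensator_sum N (kreg s).
have {}GE P : M P -> \int[P]_w X w + \int[P]_w G w = c.
  move=> MP; have := GE P MP; rewrite min0n (minn_idPl Nks) fc.
  rewrite probability_Rintegral_cst => <-; congr (_ + _).
  have [smf _ _] := kreg s.
  have ifN : P.-integrable [set: T] (EFin \o f N).
    by have := supermartingale_integrable N smf MP; rewrite (minn_idPl Nks).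
  apply: ae_eq_Rintegral => //; first exact: iX.
  by have := ess_sup_terminal MP; apply: filterS => w ->.
split; first by rewrite c0.
(* Division by [c] is impossible when [c = 0], but then the nonnegative [X] has mean 0 under every
   measure and [xi0] superhedges it at price 0. *)
have [c_eq0|c_neq0] := eqVneq c 0.
  exists xi0 => //; have [_ ixi0 _] := A0xi0.
  apply/(superhedgesP filtF _ mX iX ixi0) => P MP A FA; rewrite c_eq0 mul0r.
  have mA := filtration_measurable filtF FA.
  have iXA := integrableS measurableT mA (@subsetT _ A) (iX MP).
  rewrite -c_eq0 -(GE P MP); apply: (@le_trans _ _ (\int[P]_w X w)).
    rewrite -lee_fin !EFin_Rintegral//; last exact: iX.
    apply: ge0_subset_integral => //; last by move=> w _; rewrite lee_fin.
    exact: measurable_int (iX MP).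
  by rewrite lerDl Rintegral_ge0.
have c_gt0 : 0 < c by rewrite lt_neqAle eq_sym c_neq0.
pose xi w := c^-1 * (X w + G w).
have iXG P : M P -> P.-integrable [set: T] (EFin \o (fun w => X w + G w)).
  by move=> MP; exact: (integrableD measurableT (iX MP) (iG P MP)).
have ixi : integrable_all M xi.
  by move=> P MP; exact: (integrableZl measurableT c^-1 (iXG P MP)).
exists xi.
  apply/A0P; split => // [w|P MP].
    by rewrite mulr_ge0 ?invr_ge0 ?addr_ge0.
  rewrite RintegralZl//; last exact: iXG.
  by rewrite RintegralD//; [rewrite GE// mulVf|exact: iX|exact: iG].
apply/(superhedgesP filtF _ mX iX ixi) => P MP A FA.
have mA := filtration_measurable filtF FA.
have iS Y : P.-integrable [set: T] (EFin \o Y) -> P.-integrable A (EFin \o Y).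
  exact: integrableS.
rewrite -RintegralZl//; last by apply: iS; exact: ixi.
apply: le_Rintegral => //.
- by apply: iS; exact: iX.
- by apply: iS; exact: (integrableZl measurableT c (ixi P MP)).
- by move=> w _; rewrite /xi mulrA divff// mul1r lerDl.
Qed.

End ess_sup_process.
End regularity.

(** * The fair price and its value under local regularity *)

Unset Implicit Arguments.

Theorem theorem5p1 (d : measure_display) (T : measurableType d) (R : realType)
    (F : nat -> set (set T)) (M : set (probability T R))
    (N : nat) (fN : T -> R) (alpha0 : R) (xi0 : T -> R)
    (filtF : filtration F) (F0 : F 0%N = [set set0; [set: T]])
    (M_neq0 : M !=set0) (M_convex : convex_measures M)
    (M_equiv : equivalent_measures M)
    (A0_ui : forall P, M P -> uniformly_integrable P (A0 M))
    (fN_ge0 : forall w, 0 <= fN w) (fN_meas : measurable_wrt (F N) fN)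
    (fN_int : integrable_all M fN)
    (alpha0_ge0 : 0 <= alpha0) (xi0_A0 : A0 M xi0)
    (fN_xi0 : superhedges F M N fN alpha0 xi0) :
  exists f0 : R,
    [/\ is_fair_price F M N fN alpha0 f0,
        (ereal_sup [set 'E_P[fN] | P in M]%E <= f0%:E)%E &
        forall f : nat -> T -> R,
          (forall m, is_ess_sup M [set condexp P (F m) fN | P in M] (f m)) ->
          local_regular_supermartingale F M f ->
          f0%:E = ereal_sup [set 'E_P[fN] | P in M]%E].
Proof.
set G := price_set F M N fN alpha0.
have Galpha0 : G alpha0 by split; [rewrite alpha0_ge0 lexx|exists xi0].
have EfN P : M P -> ('E_P[fN] = (\int[P]_w fN w)%:E)%E.
  by move=> MP; apply/Rintegral_expectation => //; exact: fN_int.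
have sup_le : (ereal_sup [set 'E_P[fN] | P in M]%E <= (inf G)%:E)%E.
  apply: ge_ereal_sup => _ [P MP <-]; rewrite EfN// lee_fin.
  apply: lb_le_inf; first by exists alpha0.
  by move=> a Ga; exact: price_set_expectation_le Ga MP.
exists (inf G); split => // [|f ess_f regf].
  by apply: fair_price_exists => //; exists alpha0.
apply/eqP; rewrite eq_le sup_le andbT.
have mf0 : measurable_wrt (F 0%N) (f 0%N) by have [[fad _ _] _ _] := regf.
have [c [fc cub club]] := ess_sup_initial filtF F0 M_neq0 fN_int ess_f mf0.
have [P0 MP0] := M_neq0.
have c_bounds : 0 <= c <= alpha0.
  apply/andP; split; first by apply: le_trans (cub _ MP0); exact: Rintegral_ge0.
  by apply: club => P MP; exact: price_set_expectation_le Galpha0 MP.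
(* The initial value [c] mediates: it is an admissible price, hence at least the infimum, and it
   lies below every upper bound of the means. *)
apply: (@le_trans _ _ c%:E).
  rewrite lee_fin; apply: ge_inf; first exact: price_set_lbound.
  exact: (price_set_initial filtF F0 M_equiv M_neq0 fN_meas fN_int ess_f
    xi0_A0 fN_xi0).
have supE P : M P -> ((\int[P]_w fN w)%:E <= ereal_sup [set 'E_P[fN] | P in M])%E.
  by move=> MP; rewrite -EfN//; apply: ereal_sup_ubound; exists P.
(* [club] compares [c] with real bounds only, so the extended supremum must first be shown finite: a
   mean under [P0] bounds it below, [inf G] above. *)
have sup_fin : ereal_sup [set 'E_P[fN] | P in M]%E \is a fin_num.
  rewrite fin_numE gt_eqF ?(lt_le_trans _ (supE _ MP0)) ?ltNyr//=.
  by rewrite lt_eqF// (le_lt_trans sup_le) ?ltry.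
rewrite -(fineK sup_fin) lee_fin; apply: club => P MP.
by rewrite -lee_fin (fineK sup_fin); exact: supE.
Qed.
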